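(* Let $q\equiv 3\pmod 4$ be an odd prime power. Then $(\mathbb F_q,\operatorname{Dev}D_0^2\cup\operatorname{Dev}D_1^2)$ is a $3$-$(q,\frac{q-1}{2},\frac{q-7}{4})$ adesign.
   Context: $D_0^2$ is the set of nonzero squares in $\mathbb F_q$ and $D_1^2$ the set of non-squares. $\operatorname{Dev}C=\{C+g\mid g\in\mathbb F_q\}$; the union is a collection of $2q$ blocks. A $t$-$(v,k,\lambda)$ adesign is an incidence structure with $v$ points and blocks of size $k$ such that every $t$-subset of points lies in exactly $\lambda$ or exactly $\lambda+1$ blocks, both values occurring.
   Formalization: The formal theorem assumes q ≥ 7, excluding only q = 3, where (q-7)/4 = -1 and the claim fails because the only 3-subset of the field lies in 0 blocks, so the value λ = -1 never occurs. *)

(* Defs.v *)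
From HB Require Import structures.
From mathcomp Require Import all_boot all_algebra.

Set Implicit Arguments.
Unset Strict Implicit.
Unset Printing Implicit Defensive.

Import GRing.Theory.
Local Open Scope ring_scope.

(* Blocks are listed with multiplicity, so [B] is an incidence structure on P
   in which repeated blocks are allowed and counted separately. *)
Section Adesign.

Variables (P : finType) (B : seq {set P}).

Definition block_count (T : {set P}) : nat :=
  count (fun b : {set P} => T \subset b) B.

Record adesign (t v k lambda : nat) : Prop := Adesign {
  adesign_points : #|P| = v;
  adesign_block_size : forall b, b \in B -> #|b| = k;
  adesign_cover : forall T : {set P}, #|T| = t ->
    block_count T = lambda \/ block_count T = lambda.+1;
  adesign_low : exists T : {set P}, #|T| = t /\ block_count T = lambda;
  adesign_high : exists T : {set P}, #|T| = t /\ block_count T = lambda.+1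
}.

End Adesign.

Definition translate (V : finZmodType) (C : {set V}) (g : V) : {set V} :=
  [set x + g | x in C].

(* One entry for each g, hence exactly #|V| blocks. *)
Definition Dev (V : finZmodType) (C : {set V}) : seq {set V} :=
  [seq translate C g | g : V].

Definition nonzero_squares (F : finFieldType) : {set F} :=
  [set x : F | (x != 0) && [exists y : F, x == y ^+ 2]].

Definition nonsquares (F : finFieldType) : {set F} :=
  [set x : F | ~~ [exists y : F, x == y ^+ 2]].

(* Main.v *)
(** With [chi] the quadratic character of F, the number of blocks through
    three distinct points [a, b, c] is the number of [g] at which the signs
    [chi (a - g)], [chi (b - g)], [chi (c - g)] are nonzero and equal.  Three
    signs [x, y, z] are equal iff [1 + x y + y z + x z] is 4, and it is 0
    otherwise; as [\sum_g chi (a - g) chi (b - g) = -1] for [a != b], summing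
    over [g] gives [q - 6 + (u v + v w + u w)] for four times the block count,
    where [u = chi (a - b)], [v = chi (b - c)], [w = chi (c - a)], because
    [chi (-1) = -1].  The count is therefore (q - 3) / 4 when [u = v = w] and
    (q - 7) / 4 otherwise. *)

Require Import Defs.
From mathcomp Require Import all_boot all_algebra all_field.
From mathcomp Require Import zify ring.

Set Implicit Arguments.
Unset Strict Implicit.
Unset Printing Implicit Defensive.

Import GRing.Theory Num.Theory.
Local Open Scope ring_scope.

(** * Translates, block counts and three-element sets *)

Lemma translateP (V : finZmodType) (C : {set V}) (g x : V) :
  (x \in translate C g) = (x - g \in C).
Proof.
apply/imsetP/idP => [[y yC ->]|xC]; first by rewrite addrK.
by exists (x - g) => //; rewrite subrK.
Qed.

Lemma card_translate (V : finZmodType) (C : {set V}) (g : V) :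
  #|translate C g| = #|C|.
Proof. by rewrite card_imset //; apply: addIr. Qed.

Lemma block_count_Dev (V : finZmodType) (C T : {set V}) :
  block_count (Dev C) T = (\sum_g (T \subset translate C g : nat))%N.
Proof.
rewrite /block_count /Dev count_map -sumn_count sumnE big_map.
by rewrite big_enum.
Qed.

Lemma cards3P (T : finType) (A : {set T}) :
  #|A| = 3 -> exists a b c,
    [/\ A = [set a; b; c], a != b, b != c & a != c].
Proof.
move=> A3; have /card_gt0P[a aA] : (0 < #|A|)%N by rewrite A3.
have /eqP/cards2P[b [c [bc Abc]]] : #|A :\ a| = 2.
  by move: (cardsD1 a A); rewrite aA A3; lia.
have /setD1P[ba _] : b \in A :\ a by rewrite Abc !inE eqxx.
have /setD1P[ca _] : c \in A :\ a by rewrite Abc !inE eqxx orbT.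
exists a, b, c; split; rewrite // 1?eq_sym //.
by rewrite -(setD1K aA) Abc setUA.
Qed.

(** [u * v + v * w + w * u] is 3 when the signs agree and -1 otherwise. The bound [7 <= k] keeps the
    truncated subtraction exact. *)
Lemma three_signs_count (k N : nat) (u v w : int) :
    k = 3 %[mod 4] -> (7 <= k)%N ->
    u = 1 \/ u = -1 -> v = 1 \/ v = -1 -> w = 1 \/ w = -1 ->
    4 * N%:Z = k%:Z - 6 + (u * v + v * w + w * u) ->
  N = ((k - 7) %/ 4 + ((u == v) && (v == w)))%N.
Proof.
by move=> k4 k7 [] -> [] -> [] -> /=; lia.
Qed.

(** * The quadratic character and its multiplicativity *)

Section QuadraticCharacter.

Variable F : finFieldType.

(** The quadratic character, valued in [int] so that its sums are not reduced modulo the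
    characteristic. *)
Definition chi (x : F) : int :=
  (x \in nonzero_squares F)%:Z - (x \in nonsquares F)%:Z.

Lemma nonzero_squaresE x :
  (x \in nonzero_squares F) = (x != 0) && (x \notin nonsquares F).
Proof. by rewrite !inE negbK. Qed.

Lemma nonsquares0 : 0 \notin nonsquares F.
Proof. by rewrite inE negbK; apply/existsP; exists 0; rewrite expr0n. Qed.

Lemma nonzero_squares1 : 1 \in nonzero_squares F.
Proof. by rewrite inE oner_eq0; apply/existsP; exists 1; rewrite expr1n. Qed.

Lemma chi0 : chi 0 = 0.
Proof. by rewrite /chi nonzero_squaresE eqxx (negPf nonsquares0). Qed.

Lemma chi_sign x : x != 0 -> chi x = 1 \/ chi x = -1.
Proof.
by move=> x0; rewrite /chi nonzero_squaresE x0; case: (x \in _); [right | left].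
Qed.

Lemma chi_eq1 x : (chi x == 1) = (x \in nonzero_squares F).
Proof. rewrite /chi nonzero_squaresE; case: (eqVneq x 0) => [->|_] /=.
  by rewrite (negPf nonsquares0).
by case: (x \in _). Qed.

Lemma chi1 : chi 1 = 1.
Proof. by apply/eqP; rewrite chi_eq1 nonzero_squares1. Qed.

Lemma chi_eqN1 x : (chi x == -1) = (x \in nonsquares F).
Proof.
rewrite /chi nonzero_squaresE; case: (eqVneq x 0) => [->|_] /=.
  by rewrite (negPf nonsquares0).
by case: (x \in _).
Qed.

Hypothesis F_mod4 : #|F| = 3 %[mod 4].

Let m := (#|F| %/ 2)%N.

Lemma card_half : #|F| = m.*2.+1.
Proof. by move: F_mod4; rewrite /m; lia. Qed.

Lemma odd_half : odd m.
Proof. by move: F_mod4; rewrite /m; lia. Qed.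

Lemma euler_pow_sign (x : F) : x != 0 -> x ^+ m = 1 \/ x ^+ m = -1.
Proof.
move=> x0; have /eqP : (x ^+ m) ^+ 2 = 1.
  apply: (mulfI x0); rewrite -exprM muln2 -exprS -card_half mulr1.
  exact: expf_card.
by rewrite sqrf_eq1 => /orP[] /eqP; [left | right].
Qed.

(** Translation by 1 permutes F, so adding 1 to every element leaves the sum of all elements
    unchanged. *)
Lemma natr_card : #|F|%:R = 0 :> F.
Proof.
have : \sum_(g : F) (g + 1) = \sum_(g : F) g.
  rewrite [RHS](reindex_inj (addIr 1)); exact: eq_bigr.
by rewrite big_split /= sumr_const -[RHS]addr0 => /addrI.
Qed.

Lemma oner_neqN1 : 1 != -1 :> F.
Proof.
apply/eqP => eq1N; have /eqP := natr_card.
have two0 : 1 *+ 2 = 0 :> F by rewrite mulr2n {2}eq1N subrr.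
rewrite card_half -addn1 natrD -muln2 natrM two0 mulr0 add0r.
by rewrite oner_eq0.
Qed.

(** Euler's criterion. *)
Lemma chi_pow x : (chi x)%:~R = x ^+ m.
Proof.
case: (eqVneq x 0) => [->|x0].
  by rewrite chi0 expr0n; case: m odd_half.
have [sq|] := boolP (x \in nonzero_squares F).
  have /eqP -> := etrans (chi_eq1 x) sq.
  move: sq; rewrite inE x0 /= => /existsP[y /eqP xy]; rewrite xy -exprM mul2n.
  have y0 : y != 0 by apply: contraNneq x0 => y0; rewrite xy y0 expr0n.
  by apply: (mulfI y0); rewrite -exprS -card_half expf_card mulr1.
rewrite nonzero_squaresE x0 negbK => nsq.
have /eqP -> := etrans (chi_eqN1 x) nsq; rewrite rmorphN1.
have [xm1|-> //] := euler_pow_sign x0.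
(* Since [m] is odd, [x ^+ m = 1] would make [x = x ^+ m.+1] the square of [x ^+ uphalf m]. *)
move: nsq; rewrite inE => /negP[]; apply/existsP; exists (x ^+ uphalf m).
have m1 : (uphalf m * 2)%N = m.+1 by move: odd_half; lia.
by rewrite -exprM m1 exprS xm1 mulr1.
Qed.

Lemma chi_range x : chi x \in [:: 0; 1; -1].
Proof.
by case: (eqVneq x 0) => [->|/chi_sign[] ->]; rewrite ?chi0.
Qed.

(** Identities between signs can thus be checked in F, where [chi] is a power map: 0, 1 and -1 stay
    distinct there. *)
Lemma chi_inj (s t : int) :
  s \in [:: 0; 1; -1] -> t \in [:: 0; 1; -1] -> s%:~R = t%:~R :> F -> s = t.
Proof.
have N1 := oner_neqN1.
have one0 := oner_eq0 F.
rewrite !inE => /or3P[]/eqP -> /or3P[]/eqP -> //;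
  rewrite ?mulrN1z ?mulr0z ?mulr1z => /eqP;
  by rewrite ?[0 == _]eq_sym ?oppr_eq0 ?one0 ?[-1 == _]eq_sym ?(negPf N1).
Qed.

Lemma chiM x y : chi (x * y) = chi x * chi y.
Proof.
apply: chi_inj; first exact: chi_range.
  by have := chi_range x; have := chi_range y;
    rewrite !inE => /or3P[]/eqP -> /or3P[]/eqP ->.
by rewrite intrM !chi_pow exprMn.
Qed.

Lemma chiN x : chi (- x) = - chi x.
Proof.
apply: chi_inj; first exact: chi_range.
  by have := chi_range x; rewrite !inE => /or3P[]/eqP ->.
by rewrite rmorphN /= !chi_pow exprNn -signr_odd odd_half mulN1r.
Qed.

Lemma chi_sqr x : x != 0 -> chi x * chi x = 1.
Proof. by case/chi_sign => ->. Qed.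

(** * Sizes of the two classes and character sums *)

Lemma sum_chi : \sum_x chi x = 0.
Proof.
have : \sum_x chi x = - \sum_x chi x; last by lia.
rewrite {1}(reindex_inj oppr_inj) /= -sumrN.
by apply: eq_bigr => x _; rewrite chiN.
Qed.

(** Negation exchanges the two classes, as [chi (- x) = - chi x]. *)
Lemma card_nonsquares : #|nonsquares F| = #|nonzero_squares F|.
Proof.
rewrite -(card_imset _ (@oppr_inj F)); apply: eq_card => x.
rewrite -chi_eq1; apply/imsetP/eqP => [[y + ->]|x1].
  by rewrite -chi_eqN1 chiN => /eqP ->.
by exists (- x); rewrite ?opprK // -chi_eqN1 chiN x1.
Qed.

Lemma card_nonzero_squares : #|nonzero_squares F| = m.
Proof.
have F0 : #|[set: F] :\ 0| = m.*2.
  have := cardsD1 (0 : F) [set: F].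
  by rewrite cardsT card_half in_setT add1n => -[].
have : (#|nonzero_squares F| + #|nonsquares F|)%N = m.*2.
  rewrite -F0 -(cardsID (nonzero_squares F) ([set: F] :\ 0)).
  congr (_ + _)%N; apply: eq_card => x.
    by rewrite in_setI in_setD1 in_setT nonzero_squaresE; case: (x != 0).
  rewrite in_setD in_setD1 in_setT nonzero_squaresE andbT.
  case: (eqVneq x 0) => [->|_] /=; first by rewrite (negPf nonsquares0).
  by rewrite negbK andbT.
by rewrite card_nonsquares; lia.
Qed.

(* Substituting [z = 1 + d / h] turns [chi h * chi (h + d)] into [chi z], with
   [z] ranging over all values but 1. *)
Lemma sum_chi_shift d : d != 0 -> \sum_h chi h * chi (h + d) = -1.
Proof.
(* The goal's -1 is rewritten as the sum of [chi z] over [z != 1]. *)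
move=> d0; have /eqP := sum_chi; rewrite (bigD1 1) //= chi1.
rewrite addrC addr_eq0 => /eqP <-.
rewrite (bigD1 0) //= chi0 mul0r add0r.
rewrite [RHS](reindex (fun h => 1 + d / h)) /=.
  apply: eq_big => [h|h h0].
    by rewrite -[in RHS]subr_eq0 [1 + _]addrC addrK mulf_eq0 invr_eq0
      (negPf d0).
  have -> : h + d = h * (1 + d / h) by field.
  by rewrite chiM mulrA chi_sqr ?mul1r.
exists (fun z => d / (z - 1)) => h /=; rewrite inE => h0.
  have {}h0 : h != 0.
    by apply: contraNneq h0 => ->; rewrite invr0 mulr0 addr0.
  by rewrite [1 + _]addrC addrK; field; rewrite ?d0 ?h0.
by field; rewrite subr_eq0 h0.
Qed.

(** The substitution [h = a - g] reduces this to the shift by [b - a]. *)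
Lemma sum_chi_pair a b : a != b -> \sum_g chi (a - g) * chi (b - g) = -1.
Proof.
move=> ab; rewrite -(@sum_chi_shift (b - a)) ?subr_eq0 1?eq_sym //.
rewrite [RHS](reindex_inj (subrI a)) /=; apply: eq_bigr => g _.
by congr (_ * chi _); ring.
Qed.

(** * Blocks through a triple *)

(** At [a - g], [b - g], [c - g] this counts which of the two translates by [g] contain [a], [b] and
    [c]. *)
Definition equal_signs (x y z : F) : nat :=
  [&& x \in nonzero_squares F, y \in nonzero_squares F
    & z \in nonzero_squares F]
  + [&& x \in nonsquares F, y \in nonsquares F & z \in nonsquares F].

(** The first line of the right side is 4 or 0 when all signs are nonzero. By distinctness at most
    one argument vanishes; the form then keeps 1 plus one product, which the matching correction
    cancels. *)
Lemma equal_signsE x y z : x != y -> y != z -> x != z ->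
  4 * (equal_signs x y z)%:Z =
    1 + chi x * chi y + chi y * chi z + chi z * chi x
    - (if x == 0 then 1 + chi y * chi z else 0)
    - (if y == 0 then 1 + chi z * chi x else 0)
    - (if z == 0 then 1 + chi x * chi y else 0).
Proof.
move=> xy yz xz; rewrite /equal_signs -!chi_eq1 -!chi_eqN1.
case: (eqVneq x 0) => [x0|/chi_sign x_sign].
  move: xy xz; rewrite x0 chi0 ![0 == _]eq_sym => /[dup] /negPf -> y0.
  by move=> /[dup] /negPf -> z0; lia.
case: (eqVneq y 0) => [y0|/chi_sign y_sign].
  by move: yz; rewrite y0 chi0 [0 == _]eq_sym => /negPf ->; lia.
case: (eqVneq z 0) => [z0|/chi_sign z_sign]; first by rewrite z0 chi0; lia.
by case: x_sign => ->; case: y_sign => ->; case: z_sign => ->.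
Qed.

Lemma block_count_triple a b c : a != b -> b != c -> a != c ->
  let u := chi (a - b) in let v := chi (b - c) in let w := chi (c - a) in
  4 * (block_count (Dev (nonzero_squares F) ++ Dev (nonsquares F))
        [set a; b; c])%:Z
  = #|F|%:Z - 6 + (u * v + v * w + w * u).
Proof.
move=> ab bc ac u v w.
have -> : block_count (Dev (nonzero_squares F) ++ Dev (nonsquares F))
    [set a; b; c] = (\sum_g equal_signs (a - g)%R (b - g)%R (c - g)%R)%N.
  rewrite /block_count count_cat -!/(block_count _ _) !block_count_Dev.
  rewrite -big_split /=; apply: eq_bigr => g _.
  by rewrite !subUset !sub1set !translateP -!andbA.
have neq_sub x y g : x != y -> x - g != y - g.
  by rewrite (inj_eq (addIr (- g))).
rewrite (big_morph Posz PoszD (erefl _)) mulr_sumr.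
under eq_bigr => g _ do
  rewrite equal_signsE ?neq_sub // !subr_eq0 ![_ == g]eq_sym.
(* Each correction lives at a single [g], namely [a], [b] or [c]. *)
rewrite !(sumrB, big_split) /= -!big_mkcond !big_pred1_eq sumr_const.
have ca : c != a by rewrite eq_sym.
rewrite !sum_chi_pair // natz -[#|xpredT|]/(#|F|).
(* Orienting all differences cyclically gives for instance [chi (b - a) * chi (c - a) = - (u * w)],
   so the corrections add up to [-3 + (u * v + v * w + w * u)]. *)
rewrite -(opprB a b) -(opprB b c) -(opprB c a) !chiN -/u -/v -/w; ring.
Qed.

(** * Both counts occur *)

Lemma nonzero_squares_succ :
  exists2 x, x \in nonzero_squares F & x + 1 \in nonsquares F.
Proof.
have [/exists_inP[x x_sq x1_nsq]|/exists_inPn all_sq] :=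
  boolP [exists x in nonzero_squares F, x + 1 \in nonsquares F].
  by exists x.
(* Adding 1 would then preserve the nonzero squares, -1 not being one of them; starting from 1 they
   would contain every positive multiple of 1, in particular [#|F|%:R = 0]. *)
have succ_sq x : x \in nonzero_squares F -> x + 1 \in nonzero_squares F.
  move=> x_sq; rewrite nonzero_squaresE all_sq // andbT addr_eq0.
  by apply: contraTneq x_sq => ->; rewrite -chi_eq1 chiN chi1.
have nat_sq n : n.+1%:R \in nonzero_squares F.
  elim: n => [|n IHn]; first exact: nonzero_squares1.
  by rewrite -addn1 natrD succ_sq.
by have := nat_sq m.*2; rewrite -card_half natr_card nonzero_squaresE eqxx.
Qed.

Lemma block_count_cyclic a b c : (7 <= #|F|)%N ->
    a != b -> b != c -> a != c ->
  block_count (Dev (nonzero_squares F) ++ Dev (nonsquares F)) [set a; b; c]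
  = ((#|F| - 7) %/ 4 + ((chi (a - b)%R == chi (b - c)%R)
      && (chi (b - c)%R == chi (c - a)%R)))%N.
Proof.
move=> F_ge7 ab bc ac; apply: three_signs_count => //.
- by apply: chi_sign; rewrite subr_eq0.
- by apply: chi_sign; rewrite subr_eq0.
- by apply: chi_sign; rewrite subr_eq0 eq_sym.
- exact: block_count_triple.
Qed.

Lemma squares_nonsquares_adesign : (7 <= #|F|)%N ->
  adesign (Dev (nonzero_squares F) ++ Dev (nonsquares F))
    3 #|F| ((#|F| - 1) %/ 2) ((#|F| - 7) %/ 4).
Proof.
move=> F_ge7.
have card3 (a b c : F) : a != b -> b != c -> a != c -> #|[set a; b; c]| = 3.
  by move=> ab bc ac; rewrite setUC cardsU1 !inE cards2 ab ![c == _]eq_sym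
    (negPf ac) (negPf bc).
split=> //.
- move=> B; rewrite mem_cat => /orP[] /mapP[g _ ->].
    by rewrite card_translate card_nonzero_squares /m; lia.
  by rewrite card_translate card_nonsquares card_nonzero_squares /m; lia.
- move=> T /cards3P[a [b [c [-> ab bc ac]]]].
  rewrite block_count_cyclic //.
  by case: (_ && _); [right; rewrite addn1 | left; rewrite addn0].
(* For nonzero squares [x != y], the triple 0, [x], [y] has first sign [chi (- x) = -1] and last
   sign [chi y = 1], so the signs are not all equal. *)
- have /card_gt1P[x [y [x_sq y_sq xy]]] : (1 < #|nonzero_squares F|)%N.
    by rewrite card_nonzero_squares /m; lia.
  have /eqP chix := etrans (chi_eq1 x) x_sq.
  have /eqP chiy := etrans (chi_eq1 y) y_sq.
  have x0 : 0 != x by move: x_sq; rewrite nonzero_squaresE eq_sym => /andP[].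
  have y0 : 0 != y by move: y_sq; rewrite nonzero_squaresE eq_sym => /andP[].
  exists [set 0; x; y]; split; first exact: card3.
  rewrite block_count_cyclic // sub0r subr0 chiN chix chiy.
  by case: eqVneq => [<-|]; rewrite addn0.
(* The triple 0, [x + 1], 1 has signs [chi (- (x + 1))], [chi x] and [chi 1], all equal to 1. *)
- have [x x_sq x1_nsq] := nonzero_squares_succ.
  have /eqP chix := etrans (chi_eq1 x) x_sq.
  have /eqP chix1 := etrans (chi_eqN1 (x + 1)) x1_nsq.
  have x10 : 0 != x + 1.
    by apply: contraTneq x1_nsq => <-; apply: nonsquares0.
  have x11 : x + 1 != 1.
    by rewrite -subr_eq0 addrK; move: x_sq; rewrite nonzero_squaresE => /andP[].
  have one0 : (0 : F) != 1 by rewrite eq_sym oner_eq0.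
  exists [set 0; x + 1; 1]; split; first exact: card3.
  by rewrite block_count_cyclic // sub0r chiN chix1 addrK chix subr0 chi1 addn1.
Qed.

End QuadraticCharacter.

Local Close Scope ring_scope.

Theorem theorem11 (q : nat) (F : finFieldType) (card_F : #|F| = q)
    (q_mod4 : q = 3 %[mod 4]) (q_ge7 : 7 <= q) :
  adesign (Dev (nonzero_squares F) ++ Dev (nonsquares F))
    3 q ((q - 1) %/ 2) ((q - 7) %/ 4).
Proof.
by rewrite -card_F in q_mod4 q_ge7 *; apply: squares_nonsquares_adesign.
Qed.
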